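(* Let $X$ be a locally compact Hausdorff space with a Borel measure $\mu$ such that $0<\mu(X)<\infty$ and such that the only class $[f]\in\mathbb{TP}(X)$ with $f$ $\mu$-a.e. equal to a constant is the class of constants. Every lower (respectively upper) tropical polytope $T\subseteq\mathbb{TP}(X)$ contains only finitely many extremals. The set of all extremals of $T$ generates $T$ and is minimal among all generating sets of $T$.
   Context: $BC(X)$: bounded continuous real functions on $X$; $\mathbb{TP}(X)=BC(X)/(\text{constants})$, $[f]$ the class of $f$, metric $\rho([f],[g])=\sup(g-f)-\inf(g-f)$. $\underline{f}=f-\inf f$, $\overline{f}=f-\sup f$. For $\alpha=[f],\beta=[g]$, $d=\rho(\alpha,\beta)$: lower tropical segment $\{[\min(t,\underline{g-f})+f]:t\in[0,d]\}$, upper tropical segment $\{[\max(-t,\overline{g-f})+f]:t\in[0,d]\}$. Lower (upper) tropically convex sets contain the lower (upper) segment between any two of their points; $\underline{\mathrm{tconv}}(S)$ ($\overline{\mathrm{tconv}}(S)$) is the intersection of all lower (upper) tropically convex sets containing $S$, and $S$ is then called a generating set of it. A lower (upper) tropical polytope is $\underline{\mathrm{tconv}}(S)$ ($\overline{\mathrm{tconv}}(S)$) for finite $S$. For a lower (resp. upper) tropically convex set $T$, an element $\alpha\in T$ is an extremal of $T$ if $\alpha\notin\underline{\mathrm{tconv}}(T\setminus\{\alpha\})$ (resp. $\alpha\notin\overline{\mathrm{tconv}}(T\setminus\{\alpha\})$). *)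

(* Defs.v *)
From HB Require Import structures.
From mathcomp Require Import all_boot all_order all_algebra generic_quotient ring_quotient.
From mathcomp Require Import all_classical all_reals all_analysis.

Set Implicit Arguments.
Unset Strict Implicit.
Unset Printing Implicit Defensive.

Import Order.TTheory GRing.Theory Num.Theory.
Import numFieldNormedType.Exports.

Local Open Scope classical_set_scope.
Local Open Scope ring_scope.
Local Open Scope quotient_scope.

(* [X] is pointed because the library's generated sigma-algebras require it;
   mathematically this only says that [X] is nonempty, which also makes
   [sup] and [inf] of a bounded function meaningful. *)
Section BoundedContinuous.
Context (X : ptopologicalType) (R : realType).

Definition bc_pred : {pred X -> R} :=
  [pred f | `[< continuous f /\ bounded_fun f >]].

Lemma bc_predP (f : X -> R) :
  reflect (continuous f /\ exists M, forall x, `|f x| <= M) (f \in bc_pred).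
Proof.
apply: (iffP (asboolP _)) => -[cf].
  move=> bf; split => //; have PF := globally_properfilter (I : [set: X] point).
  by have /ex_bound[M fM] := bf; exists M => x; exact: fM.
move=> [M fM]; split => //; have PF := globally_properfilter (I : [set: X] point).
by apply/ex_bound; exists M => x _; exact: fM.
Qed.

Lemma bc_zmod_closed : zmod_closed bc_pred.
Proof.
split=> [|f g].
  apply/bc_predP; split; first exact: cst_continuous.
  by exists 0 => x; rewrite normr0.
move=> /bc_predP[cf [M fM]] /bc_predP[cg [N gN]]; apply/bc_predP; split.
  by move=> x; apply: continuousB; [exact: cf|exact: cg].
by exists (M + N) => x; rewrite (le_trans (ler_normB _ _))// lerD.
Qed.

HB.instance Definition _ := GRing.isZmodClosed.Build _ bc_pred bc_zmod_closed.

Record BC := MkBC { bc_fun :> X -> R ; bc_funP : bc_fun \in bc_pred }.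

HB.instance Definition _ := [isSub for bc_fun].
HB.instance Definition _ := [Choice of BC by <:].
HB.instance Definition _ := [SubChoice_isSubZmodule of BC by <:].

Lemma bc_cst_subproof (c : R) : (cst c : X -> R) \in bc_pred.
Proof.
by apply/bc_predP; split; [exact: cst_continuous|exists `|c|].
Qed.
Definition bc_cst c : BC := MkBC (bc_cst_subproof c).

Lemma bc_min_subproof (t : R) (f : BC) :
  (fun x => Num.min t (f x)) \in bc_pred.
Proof.
have /bc_predP[cf [M fM]] := bc_funP f; apply/bc_predP; split.
  by move=> x; apply: continuous_min; [exact: cst_continuous|exact: cf].
exists (Num.max `|t| M) => x.
by rewrite /Num.min; case: ifP => _; rewrite le_max ?lexx// fM orbT.
Qed.
Definition bc_min t f : BC := MkBC (bc_min_subproof t f).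

Lemma bc_max_subproof (t : R) (f : BC) :
  (fun x => Num.max t (f x)) \in bc_pred.
Proof.
have /bc_predP[cf [M fM]] := bc_funP f; apply/bc_predP; split.
  by move=> x; apply: continuous_max; [exact: cst_continuous|exact: cf].
exists (Num.max `|t| M) => x.
by rewrite /(Num.max t); case: ifP => _; rewrite le_max ?lexx// fM orbT.
Qed.
Definition bc_max t f : BC := MkBC (bc_max_subproof t f).

Definition bc_inf (f : BC) : R := inf (range f).
Definition bc_sup (f : BC) : R := sup (range f).

Definition bc_under (f : BC) : BC := f - bc_cst (bc_inf f).
Definition bc_over (f : BC) : BC := f - bc_cst (bc_sup f).

Lemma bc_has_sup (f : BC) : has_sup (range f).
Proof.
have /bc_predP[_ [M fM]] := bc_funP f; split; first by exists (f point), point.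
by exists M => _ [x _ <-]; rewrite (le_trans (ler_norm _)).
Qed.

Lemma bc_has_inf (f : BC) : has_inf (range f).
Proof.
have /bc_predP[_ [M fM]] := bc_funP f; split; first by exists (f point), point.
by exists (- M) => _ [x _ <-]; have := fM x; rewrite ler_norml => /andP[].
Qed.

Lemma range_bcD_cst (f : BC) (c : R) :
  range (f + bc_cst c : BC) = [set x + y | x in range f & y in [set c]].
Proof.
apply/seteqP; split=> [_ [x _ <-]|_ [_ [x _ <-]] [_ -> <-]].
  by exists (f x); [exists x|exists c].
by exists x.
Qed.

Lemma bc_supD_cst (f : BC) (c : R) : bc_sup (f + bc_cst c) = bc_sup f + c.
Proof.
by rewrite /bc_sup range_bcD_cst sup_sumE ?sup1//; exact: bc_has_sup.
Qed.

Lemma bc_infD_cst (f : BC) (c : R) : bc_inf (f + bc_cst c) = bc_inf f + c.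
Proof.
by rewrite /bc_inf range_bcD_cst inf_sumE ?inf1//; exact: bc_has_inf.
Qed.

Lemma bc_cstD (c d : R) : bc_cst (c + d) = bc_cst c + bc_cst d.
Proof. exact/val_inj. Qed.

Lemma bc_underD_cst (f : BC) (c : R) : bc_under (f + bc_cst c) = bc_under f.
Proof. by rewrite /bc_under bc_infD_cst bc_cstD opprD addrACA subrr addr0. Qed.

Lemma bc_overD_cst (f : BC) (c : R) : bc_over (f + bc_cst c) = bc_over f.
Proof. by rewrite /bc_over bc_supD_cst bc_cstD opprD addrACA subrr addr0. Qed.

Definition constants : {pred BC} := [pred f | `[< exists c, f = bc_cst c >]].

Lemma constants_zmod_closed : zmod_closed constants.
Proof.
split=> [|f g]; first by apply/asboolP; exists 0; exact/val_inj.
move=> /asboolP[c ->] /asboolP[d ->]; apply/asboolP.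
by exists (c - d); exact/val_inj.
Qed.

HB.instance Definition _ :=
  GRing.isZmodClosed.Build BC constants constants_zmod_closed.

(* The quotient group BC(X) / constants; its [0] is the class of constants,
   see [cls_eq0P]. *)
Definition TP := Quotient.quot constants.
HB.instance Definition _ := GRing.Zmodule.on TP.
HB.instance Definition _ := EqQuotient.on TP.

End BoundedContinuous.

Arguments BC X R : clear implicits.
Arguments TP X R : clear implicits.

Section TropicalConvexity.
Context (X : ptopologicalType) (R : realType).
Implicit Types (f g : BC X R) (a b : TP X R) (S T : set (TP X R)).

Local Notation cls f := (\pi_(TP X R) f).

Lemma cls_eqP f g : cls f = cls g <-> exists c, f = g + bc_cst X c.
Proof.
rewrite (rwP eqP) -Quotient.idealrBE -(rwP (asboolP _)).
split=> -[c fg]; exists c; first by rewrite -fg addrC subrK.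
by rewrite fg addrAC subrr add0r.
Qed.

Lemma cls_eq0P f : cls f = 0 <-> exists c, f = bc_cst X c.
Proof.
rewrite -[0 : TP X R](_ : cls 0 = _) ?piE// cls_eqP.
by split=> -[c ->]; exists c; rewrite add0r.
Qed.

Definition rho a b : R :=
  let h := repr b - repr a in bc_sup h - bc_inf h.

Definition lower_segment a b : set (TP X R) :=
  let f := repr a in let g := repr b in
  [set cls (bc_min t (bc_under (g - f)) + f) | t in `[0, rho a b]].

Definition upper_segment a b : set (TP X R) :=
  let f := repr a in let g := repr b in
  [set cls (bc_max (- t) (bc_over (g - f)) + f) | t in `[0, rho a b]].

(* [rho], [lower_segment] and [upper_segment] are defined on the canonical
   representatives; the next three lemmas show that any other choice of
   representatives gives the same value. *)
Lemma repr_clsP f : exists c, repr (cls f) = f + bc_cst X c.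
Proof. by apply/cls_eqP; rewrite reprK. Qed.

Let repr_diff f g : exists c, repr (cls g) - repr (cls f) = g - f + bc_cst X c.
Proof.
have [c ->] := repr_clsP f; have [d ->] := repr_clsP g; exists (d - c).
by rewrite opprD addrACA; congr (_ + _); exact/val_inj.
Qed.

Let cls_cst f g c : f = g + bc_cst X c -> cls f = cls g.
Proof. by move=> fg; apply/cls_eqP; exists c. Qed.

Lemma rhoE f g : rho (cls f) (cls g) = bc_sup (g - f) - bc_inf (g - f).
Proof.
rewrite /rho; have [c ->] := repr_diff f g.
by rewrite bc_supD_cst bc_infD_cst opprD addrACA subrr addr0.
Qed.

Lemma lower_segmentE f g :
  lower_segment (cls f) (cls g) =
  [set cls (bc_min t (bc_under (g - f)) + f) | t in `[0, rho (cls f) (cls g)]].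
Proof.
rewrite /lower_segment; have [c ->] := repr_diff f g.
have [d ->] := repr_clsP f; rewrite bc_underD_cst.
by apply: eq_imagel => t _; apply: (@cls_cst _ _ d); rewrite addrA.
Qed.

Lemma upper_segmentE f g :
  upper_segment (cls f) (cls g) =
  [set cls (bc_max (- t) (bc_over (g - f)) + f)
     | t in `[0, rho (cls f) (cls g)]].
Proof.
rewrite /upper_segment; have [c ->] := repr_diff f g.
have [d ->] := repr_clsP f; rewrite bc_overD_cst.
by apply: eq_imagel => t _; apply: (@cls_cst _ _ d); rewrite addrA.
Qed.

Definition lower_tconvex T := forall a b, T a -> T b -> lower_segment a b `<=` T.
Definition upper_tconvex T := forall a b, T a -> T b -> upper_segment a b `<=` T.

Definition lower_tconv S : set (TP X R) := smallest lower_tconvex S.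
Definition upper_tconv S : set (TP X R) := smallest upper_tconvex S.

Definition lower_tpolytope T := exists2 S, finite_set S & T = lower_tconv S.
Definition upper_tpolytope T := exists2 S, finite_set S & T = upper_tconv S.

Definition lower_extremals T : set (TP X R) :=
  [set a | T a /\ ~ lower_tconv (T `\ a) a].
Definition upper_extremals T : set (TP X R) :=
  [set a | T a /\ ~ upper_tconv (T `\ a) a].

Definition lower_generating S T := lower_tconv S = T.
Definition upper_generating S T := upper_tconv S = T.

End TropicalConvexity.

(* Main.v *)
Require Import Defs.
From HB Require Import structures.
From mathcomp Require Import all_boot all_order all_algebra generic_quotient ring_quotient.
From mathcomp Require Import all_classical all_reals all_analysis.
From mathcomp Require Import lra.

Set Implicit Arguments.
Unset Strict Implicit.
Unset Printing Implicit Defensive.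

Import Order.TTheory GRing.Theory Num.Theory.
Import numFieldNormedType.Exports.

Local Open Scope classical_set_scope.
Local Open Scope ring_scope.
Local Open Scope quotient_scope.

(* A finite set S of minimal cardinality generating T consists of extremals:
   if a is in S and U is the hull of S minus a, then a is not in U, and the
   classes of the functions min(f + s, u), with a = [f], [u] in U and s real,
   form together with a a convex set V containing T.  Moreover V minus a is
   convex: in an equation f = min(min(f + s, u), min(f + s', u')) with neither
   inner minimum equal to f, both shifts s, s' are positive, so f = min(u, u')
   and a would lie in U.  Conversely an extremal belongs to every generating
   set.  Upper convexity is the image of lower convexity under negation. *)

(** * Extremals in an abstract closure system *)

Section AbstractConvexity.
Context {P : choiceType}.
Implicit Types (C : set (set P)) (S T U V : set P) (a : P).

(** Since [V] remains convex once [a] is removed, [a] is extremal in every convex subset of [V] that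
    contains it. *)
Definition exchange_property C := forall U a, C U -> ~ U a ->
  exists V, [/\ C V, V a, U `<=` V & C (V `\ a)].

Definition extremals C T : set P := [set a | T a /\ ~ smallest C (T `\ a) a].

Lemma smallest_min_seq C S : finite_set S -> exists s : seq P,
  smallest C [set` s] = smallest C S /\
  forall s', smallest C [set` s'] = smallest C S -> (size s <= size s')%N.
Proof.
move=> /finite_seqP[s0 ->].
pose p n := `[< exists s : seq P,
  size s = n /\ smallest C [set` s] = smallest C [set` s0] >].
have pn : exists n, p n by exists (size s0); apply/asboolP; exists s0.
case: (ex_minnP pn) => _ /asboolP[s [<- ss0]] smin; exists s; split => // s' s's0.
by apply: smin; apply/asboolP; exists s'.
Qed.

(** If [S] misses [a], a convex set containing the hull minus [a] contains [S], hence the whole hull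
    and [a]. *)
Lemma extremals_sub_generating C S : extremals C (smallest C S) `<=` S.
Proof.
move=> a [Ta aT]; apply: contrapT => Sa; apply: aT => A [CA TA].
apply: (Ta A); split => // b Sb; apply: TA; split; first exact: sub_gen_smallest.
by move=> ba; apply: Sa; rewrite -ba.
Qed.

Section Exchange.
Variable C : set (set P).
Hypothesis C_bigcap : forall F : set (set P), F `<=` C -> C (\bigcap_(A in F) A).
Hypothesis C_exchange : exchange_property C.

Lemma smallest_closed S : C (smallest C S).
Proof. by apply: C_bigcap => A []. Qed.

Lemma smallest_extremals S : finite_set S ->
  smallest C (extremals C (smallest C S)) = smallest C S.
Proof.
move=> /(smallest_min_seq C)[s [<- smin]].
set T := smallest C [set` s]; apply/seteqP; split.
  by apply: smallest_sub => [|a []//]; exact: smallest_closed.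
apply: sub_smallest2r => [|a sa]; first exact: smallest_closed.
split; first exact: sub_gen_smallest.
pose s' := [seq b <- s | b != a].
have s'P b : b \in s -> b != a -> b \in s' by rewrite mem_filter => -> ->.
have Us'a : ~ smallest C [set` s'] a.
  (* Otherwise [s'] would be a strictly shorter list generating [T]. *)
  move=> Ua; suff : smallest C [set` s'] = T.
    move=> /smin; rewrite leqNgt size_filter -(count_predC (pred1 a) s).
    by rewrite -[X in (X < _)%N]add0n ltn_add2r -has_count has_pred1 sa.
  apply/seteqP; split.
    apply: sub_smallest2r => [|b /=]; first exact: smallest_closed.
    by rewrite mem_filter => /andP[].
  apply: smallest_sub => [|b sb]; first exact: smallest_closed.
  have [->//|ba] := eqVneq b a.
  by apply: sub_gen_smallest; exact: s'P.
have [V [CV Va UV CVa]] := C_exchange (@smallest_closed _) Us'a.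
have TV : T `<=` V.
  apply: smallest_sub => // b sb; have [->//|ba] := eqVneq b a.
  by apply: UV; apply: sub_gen_smallest; exact: s'P.
(* The hull of [T] minus [a] stays inside the convex set [V] minus [a]. *)
by move=> /(smallest_sub CVa (setSD TV))[_]; exact.
Qed.

Lemma polytope_extremals T : (exists2 S, finite_set S & T = smallest C S) ->
  [/\ finite_set (extremals C T), smallest C (extremals C T) = T
    & forall S, smallest C S = T -> S `<=` extremals C T -> S = extremals C T].
Proof.
move=> [S finS ->]; split.
- exact: sub_finite_set (@extremals_sub_generating C S) finS.
- exact: smallest_extremals.
- move=> S' S'T S'ext; apply/seteqP; split => //.
  by rewrite -S'T; exact: extremals_sub_generating.
Qed.

End Exchange.
End AbstractConvexity.

(** * Transfer of closure systems along an involution *)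

Section InvolutionTransfer.
Context {P : choiceType} (phi : P -> P) (phiK : involutive phi).
Variables C C' : set (set P).
Hypothesis C'E : forall T, C' T <-> C (phi @^-1` T).

Lemma bigcap_closed_preimage :
  (forall F : set (set P), F `<=` C -> C (\bigcap_(A in F) A)) ->
  forall F : set (set P), F `<=` C' -> C' (\bigcap_(A in F) A).
Proof.
move=> CF F FC'; apply/C'E; rewrite preimage_bigcap.
rewrite -(bigcap_image F (fun A => phi @^-1` A) id).
by apply: CF => _ [A FA <-]; apply/C'E; exact: FC'.
Qed.

Lemma exchange_property_preimage : exchange_property C -> exchange_property C'.
Proof.
move=> exC U a /C'E CU Ua.
have [|V [CV Va UV CVa]] := exC _ (phi a) CU; first by rewrite /preimage/= phiK.
have phiphi A : phi @^-1` (phi @^-1` A) = A.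
  by apply/seteqP; split => x; rewrite /preimage/= phiK.
exists (phi @^-1` V); split => //.
- by apply/C'E; rewrite phiphi.
- by move=> b Ub; apply: UV; rewrite /preimage/= phiK.
- apply/C'E; rewrite (_ : phi @^-1` _ = V `\ phi a)//; apply/seteqP.
  split=> x [] /=; rewrite phiK => Vx xa; split => // xa'; apply: xa.
    by rewrite xa' phiK.
  by rewrite -xa' phiK.
Qed.

End InvolutionTransfer.

(** * Tropical convexity as closure under pointwise minima *)

Section TropicalMeet.
Context (X : ptopologicalType) (R : realType).
Implicit Types (f g h u : BC X R) (a b : TP X R) (T U : set (TP X R)).
Implicit Types (c s t : R).

Local Notation cls f := (\pi_(TP X R) f).
Local Notation cst c := (bc_cst X c).

(** The pointwise minimum, written in the shape of a point of a lower segment. *)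
Definition bc_meet f g : BC X R := bc_min 0 (g - f) + f.

Lemma bcP f g : f =1 g -> f = g.
Proof. by move=> fg; apply/val_inj/funext. Qed.

Lemma bc_meetE f g x : bc_meet f g x = Num.min (f x) (g x).
Proof.
rewrite /bc_meet [LHS]/= (_ : _ x = Num.min 0 (g x - f x) + f x)//.
by rewrite addr_minl add0r subrK.
Qed.

Lemma bcD_cstE f c x : (f + cst c) x = f x + c. Proof. by []. Qed.

Lemma clsD_cst f c : cls (f + cst c) = cls f.
Proof. by apply/cls_eqP; exists c. Qed.

Lemma bc_inf_le f x : bc_inf f <= f x.
Proof. by apply: ge_inf; [case: (bc_has_inf f)|exists x]. Qed.

Lemma bc_sup_ge f x : f x <= bc_sup f.
Proof. by apply: ub_le_sup; [case: (bc_has_sup f)|exists x]. Qed.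

(** Points of a lower segment are classes of minima of translates of [f] and [g], and a class
    contains all translates of its members. *)
Lemma lower_tconvexP T : lower_tconvex T <->
  forall f g, T (cls f) -> T (cls g) -> T (cls (bc_meet f g)).
Proof.
split=> [cT f g Tf Tg|cT a b Ta Tb].
- set h := g - f.
  have hE x : h x = g x - f x by [].
  (* If [h] has constant strict sign the minimum is [f] or [g]; otherwise [- bc_inf h] lies between
     0 and [rho]. *)
  have [i0|i0] := ltP 0 (bc_inf h).
    rewrite (_ : bc_meet f g = f)//; apply: bcP => x; rewrite bc_meetE min_l//.
    by rewrite -subr_ge0 -hE (le_trans (ltW i0))// bc_inf_le.
  have [s0|s0] := ltP (bc_sup h) 0.
    rewrite (_ : bc_meet f g = g)//; apply: bcP => x; rewrite bc_meetE min_r//.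
    by rewrite -subr_le0 -hE (le_trans _ (ltW s0))// bc_sup_ge.
  apply: (cT _ _ Tf Tg); rewrite lower_segmentE -/h.
  (* At this parameter the segment point is the minimum of [f] and [g], shifted by [- bc_inf h]. *)
  exists (- bc_inf h); first by rewrite /= in_itv/= rhoE -/h; apply/andP; split; lra.
  apply/cls_eqP; exists (- bc_inf h); apply: bcP => x; rewrite bcD_cstE bc_meetE.
  rewrite (_ : _ x = Num.min (- bc_inf h) (h x - bc_inf h) + f x)// hE.
  by rewrite /Num.min; do 2 case: ifPn; rewrite -?leNgt => ? ?; lra.
- rewrite -[a]reprK -[b]reprK lower_segmentE => _ [t _ <-].
  set f := repr a; set g := repr b; set h := g - f.
  rewrite (_ : _ + _ = bc_meet (f + cst t) (g + cst (- bc_inf h))).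
    by apply: cT; rewrite clsD_cst reprK.
  apply: bcP => x; rewrite bc_meetE !bcD_cstE.
  rewrite (_ : _ x = Num.min t (g x - f x - bc_inf h) + f x)//.
  by rewrite /Num.min; do 2 case: ifPn; rewrite -?leNgt => ? ?; lra.
Qed.

Lemma lower_tconvex_bigcap (F : set (set (TP X R))) :
  F `<=` @lower_tconvex X R -> lower_tconvex (\bigcap_(A in F) A).
Proof.
move=> FC a b Fa Fb c cab A FA; exact: (FC A FA a b (Fa A FA) (Fb A FA)).
Qed.

Lemma lower_tconvex_exchange : exchange_property (@lower_tconvex X R).
Proof.
move=> U a /lower_tconvexP cU; rewrite -[a]reprK; set f := repr a => Uf.
pose V := [set b | b = cls f \/
  exists s u, U (cls u) /\ b = cls (bc_meet (f + cst s) u)].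
(* The constant between representatives is absorbed into [s] and [u], so an equality of classes
   becomes one of functions. *)
have meetP h : V (cls h) -> cls h = cls f \/
    exists s u, U (cls u) /\ h = bc_meet (f + cst s) u.
  case=> [|[s [u [Uu /cls_eqP[c ->]]]]]; first by left.
  right; exists (s + c), (u + cst c); split; first by rewrite clsD_cst.
  apply: bcP => x; rewrite bcD_cstE !bc_meetE !bcD_cstE.
  by rewrite addr_minl addrA.
have cV : lower_tconvex V.
  apply/lower_tconvexP => h h' /meetP hP /meetP h'P.
  case: hP => [/cls_eqP[c ->]|[s [u [Uu ->]]]];
  case: h'P => [/cls_eqP[c' ->]|[s' [u' [Uu' ->]]]].
  - left; apply/cls_eqP; exists (Num.min c c'); apply: bcP => x.
    by rewrite bc_meetE !bcD_cstE addr_minr.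
  - right; exists (Num.min c s'), u'; split => //; congr (cls _).
    by apply: bcP => x; rewrite !bc_meetE !bcD_cstE addr_minr minA.
  - right; exists (Num.min s c'), u; split => //; congr (cls _).
    by apply: bcP => x; rewrite !bc_meetE !bcD_cstE addr_minr minAC.
  - right; exists (Num.min s s'), (bc_meet u u'); split; first exact: cU.
    congr (cls _); apply: bcP => x.
    by rewrite !bc_meetE !bcD_cstE addr_minr minACA.
exists V; split => //; first by left.
(* This shift lifts [f] above [repr b], so the minimum is [repr b] itself. *)
- move=> b Ub; right; exists (bc_sup (repr b - f)), (repr b); rewrite reprK.
  split => //; rewrite -[LHS]reprK; congr (cls _); apply: bcP => x.
  rewrite bc_meetE bcD_cstE min_r//.
  have : repr b x - f x <= bc_sup (repr b - f) := bc_sup_ge (repr b - f) x.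
  lra.
- apply/lower_tconvexP => h h' [Vh hf] [Vh' h'f]; split.
    by move/lower_tconvexP : cV; exact.
  case: (meetP _ Vh) => [//|[s [u [Uu hE]]]].
  case: (meetP _ Vh') => [//|[s' [u' [Uu' h'E]]]].
  move=> /esym/cls_eqP[c fE].
  have fx x : f x = Num.min (h x) (h' x) + c by rewrite {1}fE bcD_cstE bc_meetE.
  have hx x : h x = Num.min (f x + s) (u x) by rewrite hE bc_meetE.
  have h'x x : h' x = Num.min (f x + s') (u' x) by rewrite h'E bc_meetE.
  (* [f] is below a translate of itself, so the shift is nonnegative; a zero
     shift would squeeze [k] to a translate of [f]. *)
  have shift_gt0 k r v : cls k <> cls f ->
      (forall x, k x = Num.min (f x + r) (v x)) ->
      (forall x, f x <= k x + c) -> 0 < r + c.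
    move=> kf kx fk; have := fk point; rewrite kx -lerBlDr le_min => /andP[rc _].
    rewrite lt_neqAle; apply/andP; split; last by lra.
    apply/eqP => rc0; apply: kf; apply/cls_eqP; exists (- c); apply: bcP => x.
    rewrite bcD_cstE; apply/eqP; rewrite eq_le lerBlDr fk andbT.
    by rewrite kx ge_min; apply/orP; left; lra.
  have sc : 0 < s + c.
    by apply: (shift_gt0 h s u) => // x; rewrite fx lerD2r ge_min lexx.
  have s'c : 0 < s' + c.
    by apply: (shift_gt0 h' s' u') => // x; rewrite fx lerD2r ge_min lexx orbT.
  (* As [f + s + c] and [f + s' + c] exceed [f] everywhere, the minimum giving [f] is attained by
     [u] or [u'] at each point. *)
  apply: Uf; rewrite (_ : cls f = cls (bc_meet u u')); first exact: cU.
  apply/cls_eqP; exists c; apply: bcP => x; rewrite bcD_cstE bc_meetE.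
  have := fx x; rewrite hx h'x /Num.min.
  by do 4 (case: ifPn => //); rewrite -?leNgt; intros; lra.
Qed.

Lemma clsN f : cls (- f) = - cls f. Proof. by rewrite piE. Qed.

Lemma bc_supN f : bc_sup (- f) = - bc_inf f.
Proof. by rewrite /bc_inf /inf opprK image_comp. Qed.

Lemma bc_infN f : bc_inf (- f) = - bc_sup f.
Proof. by rewrite -[in RHS](opprK f) bc_supN opprK. Qed.

(** Negation exchanges minima with maxima and infima with suprema, and preserves [rho]. *)
Lemma upper_segmentN a b :
  upper_segment a b = -%R @` lower_segment (- a) (- b).
Proof.
rewrite -[a]reprK -[b]reprK; set f := repr a; set g := repr b.
have gfN : - g - - f = - (g - f) by rewrite opprD.
have rhoN : rho (cls (- f)) (cls (- g)) = rho (cls f) (cls g).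
  by rewrite !rhoE gfN bc_supN bc_infN; lra.
rewrite -!clsN upper_segmentE lower_segmentE rhoN image_comp.
apply: eq_imagel => t _ /=; rewrite -clsN; congr (cls _); apply: bcP => x.
rewrite gfN /bc_over /bc_under bc_infN.
rewrite [LHS](_ : _ = Num.max (- t) (g x - f x - bc_sup (g - f)) + f x)//.
rewrite [RHS](_ : _ =
  - (Num.min t (- (g x - f x) - - bc_sup (g - f)) + - f x))//.
by rewrite /Num.min /Num.max; do 2 case: ifPn; rewrite -?leNgt => ? ?; lra.
Qed.

Lemma upper_tconvexN T : upper_tconvex T <-> lower_tconvex (-%R @^-1` T).
Proof.
split=> cT a b Ta Tb c.
  move=> abc; apply: (cT _ _ Ta Tb); rewrite upper_segmentN !opprK.
  by exists c.
rewrite upper_segmentN => -[d abd <-].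
by apply: (cT (- a) (- b)); rewrite /preimage/= ?opprK.
Qed.

End TropicalMeet.

Theorem theorem7p3 (R : realType) (X : ptopologicalType)
  (X_locally_compact : locally_compact [set: X])
  (X_hausdorff : hausdorff_space X)
  (mu : {measure set (g_sigma_algebraType (@open X)) -> \bar R})
  (mu_finite : (0 < mu [set: X] < +oo)%E)
  (mu_constant : forall f : BC X R,
     (exists c : R, {ae mu, forall x, f x = c}) -> \pi_(TP X R) f = 0) :
  (forall T : set (TP X R), lower_tpolytope T ->
     [/\ finite_set (lower_extremals T),
         lower_generating (lower_extremals T) T
       & forall S, lower_generating S T -> S `<=` lower_extremals T ->
           S = lower_extremals T]) /\
  (forall T : set (TP X R), upper_tpolytope T ->
     [/\ finite_set (upper_extremals T),
         upper_generating (upper_extremals T) T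
       & forall S, upper_generating S T -> S `<=` upper_extremals T ->
           S = upper_extremals T]).

Proof.
have lower_bigcap := @lower_tconvex_bigcap X R.
have lower_exchange := @lower_tconvex_exchange X R.
have upperN := @upper_tconvexN X R.
split=> T T_polytope.
  (* The lower notions unfold to the abstract ones for the family [lower_tconvex]. *)
  exact: (polytope_extremals lower_bigcap lower_exchange).
(* Upper convex sets inherit both closure properties from lower ones through negation. *)
apply: (polytope_extremals _ _ T_polytope).
- exact: bigcap_closed_preimage upperN lower_bigcap.
- exact: (exchange_property_preimage (@opprK _) upperN lower_exchange).
Qed.
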